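(* Let $(X,\mathcal{B}_1,\mathbf{b}_1)$ and $(Y,\mathcal{B}_2,\mathbf{b}_2)$ be coarse proximity spaces that are coarse proximity isomorphic. Then $asInd(X)=asInd(Y)$.
   Context: Coarse proximity spaces. A bornology on a set $X$ is a family $\mathcal{B}$ of subsets of $X$ that contains all singletons, is closed under taking subsets, and is closed under unions of two members. Members of $\mathcal{B}$ are called bounded; other subsets of $X$ are unbounded. A coarse proximity space is a triple $(X,\mathcal{B},\mathbf{b})$ where $\mathcal{B}$ is a bornology on $X$ and $\mathbf{b}$ is a relation on the power set of $X$ such that for all $A,B,C\subseteq X$ (writing $\bar{\mathbf{b}}$ for the negation of $\mathbf{b}$): (1) $A\mathbf{b}B\Rightarrow B\mathbf{b}A$; (2) $A\mathbf{b}B\Rightarrow A,B\notin\mathcal{B}$; (3) $A\cap B\notin\mathcal{B}\Rightarrow A\mathbf{b}B$; (4) $(A\cup B)\mathbf{b}C\iff A\mathbf{b}C$ or $B\mathbf{b}C$; (5) $A\bar{\mathbf{b}}B\Rightarrow$ there is $E\subseteq X$ with $A\bar{\mathbf{b}}E$ and $(X\setminus E)\bar{\mathbf{b}}B$. A subset $Y\subseteq X$ carries the subspace coarse proximity structure: bornology $\{B\cap Y: B\in\mathcal{B}\}$, and $A\mathbf{b}_YC\iff A\mathbf{b}C$ for $A,C\subseteq Y$. Isomorphisms. The weak asymptotic resemblance $\phi$ induced by $\mathbf{b}$ is the relation on subsets of $X$ with $A\phi B$ iff $A\mathbf{b}B'$ for every unbounded $B'\subseteq B$ and $A'\mathbf{b}B$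 for every unbounded $A'\subseteq A$. A coarse proximity map $f:(X,\mathcal{B}_1,\mathbf{b}_1)\to(Y,\mathcal{B}_2,\mathbf{b}_2)$ is a function such that $B\in\mathcal{B}_1\Rightarrow f(B)\in\mathcal{B}_2$ and $A\mathbf{b}_1B\Rightarrow f(A)\mathbf{b}_2f(B)$. Two functions $f,g$ from a set $X$ into a coarse proximity space $Y$ are close if $f(A)\phi g(A)$ for all $A\subseteq X$, where $\phi$ is the weak asymptotic resemblance of $Y$. A coarse proximity map $f:X\to Y$ is a coarse proximity isomorphism if there is a coarse proximity map $g:Y\to X$ with $g\circ f$ close to $id_X$ and $f\circ g$ close to $id_Y$. Two coarse proximity spaces are coarse proximity isomorphic if there is a coarse proximity isomorphism between them. Boundary. The discrete extension of $\mathbf{b}$ is the separated proximity $\delta$ on $X$ given by $A\delta B\iff(A\cap B\neq\emptyset$ or $A\mathbf{b}B)$. A cluster of $(X,\delta)$ is a collection $\sigma$ of nonempty subsets of $X$ such that $A\delta B$ for all $A,B\in\sigma$; if $C\delta A$ for all $A\in\sigma$ then $C\in\sigma$; and if $A\cup B\in\sigma$ then $A\in\sigma$ or $B\in\sigma$. The Smirnov compactification $\mathfrak{X}$ is the set of all clusters with the separated proximity $\delta^*$: $\mathcal{A}\delta^*\mathcal{C}$ iff $A\delta C$ for all $A,C\subseteq X$ such that $A\in\sigma$ for every $\sigma\in\mathcal{A}$ and $C\in\sigma$ for every $\sigma\in\mathcal{C}$. Its topology (closure of $\mathcal{A}$ is $\{\sigma:\{\sigma\}\delta^*\mathcal{A}\}$)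 is compact Hausdorff, and $X$ is identified with the dense set of point clusters (those containing a singleton); then $cl_{\mathfrak{X}}(A)=\{\sigma\in\mathfrak{X}:A\in\sigma\}$ for $A\subseteq X$. The boundary $\mathcal{U}X\subseteq\mathfrak{X}$ is the subspace of clusters containing no bounded set (it is compact Hausdorff). The trace of $A\subseteq X$ is $A'=cl_{\mathfrak{X}}(A)\cap\mathcal{U}X$. Dimension. A separator between disjoint subsets $A,B$ of a topological space $T$ is a set $C\subseteq T$ such that $T\setminus C=U\cup V$ with $U,V$ disjoint open in $T$, $A\subseteq U$, $B\subseteq V$. If $A\bar{\mathbf{b}}B$ in $X$, an asymptotic separator between $A$ and $B$ is a set $C\subseteq X$ such that $C'$ is a separator in $\mathcal{U}X$ between $A'$ and $B'$. The asymptotic inductive dimension: $asInd(X)=-1$ iff $X$ is bounded; for $n\ge0$, $asInd(X)\le n$ if for all $A,B\subseteq X$ with $A\bar{\mathbf{b}}B$ there is an asymptotic separator $C\subseteq X$ between $A$ and $B$ with $asInd(C)\le n-1$ ($C$ with the subspace coarse proximity structure); $asInd(X)=n$ if $n\ge-1$ is the smallest integer with $asInd(X)\le n$; $asInd(X)=\infty$ if there is no such integer. *)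

(* Defs.v *)
From HB Require Import structures.
From mathcomp Require Import all_boot all_order all_algebra.
From mathcomp Require Import all_classical all_reals.
From mathcomp Require Import topology.
Set Implicit Arguments.
Unset Strict Implicit.
Unset Printing Implicit Defensive.
Import Order.TTheory GRing.Theory Num.Theory.
Local Open Scope classical_set_scope.

HB.mixin Record isCoarseProximity (X : Type) := {
  coarse_bounded : set (set X);
  coarse_near : set X -> set X -> Prop;
  coarse_bounded1 : forall x, coarse_bounded [set x];
  coarse_boundedS : forall A B, A `<=` B -> coarse_bounded B -> coarse_bounded A;
  coarse_boundedU : forall A B,
    coarse_bounded A -> coarse_bounded B -> coarse_bounded (A `|` B);
  coarse_near_sym : forall A B, coarse_near A B -> coarse_near B A;
  coarse_near_unbounded : forall A B,
    coarse_near A B -> ~ coarse_bounded A /\ ~ coarse_bounded B;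
  coarse_nearI : forall A B, ~ coarse_bounded (A `&` B) -> coarse_near A B;
  coarse_nearU : forall A B C,
    coarse_near (A `|` B) C <-> coarse_near A C \/ coarse_near B C;
  coarse_near_strong : forall A B, ~ coarse_near A B ->
    exists E, ~ coarse_near A E /\ ~ coarse_near (~` E) B
}.

#[short(type="coarseProximityType")]
HB.structure Definition CoarseProximity := {X of isCoarseProximity X}.

Section coarse_near_theory.
Context {X : coarseProximityType}.
Implicit Types A B C : set X.

Lemma coarse_nearS A B C : A `<=` B -> coarse_near A C -> coarse_near B C.
Proof. by move=> /setUidPr <- AC; apply/coarse_nearU; left. Qed.

Lemma coarse_nearSS A A' B B' :
  A `<=` A' -> B `<=` B' -> coarse_near A B -> coarse_near A' B'.
Proof.
move=> AA' BB' AB; apply: (coarse_nearS AA').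
by apply: coarse_near_sym; apply: (coarse_nearS BB'); apply: coarse_near_sym.
Qed.

End coarse_near_theory.

Section subspace.
Context {X : coarseProximityType} (Y : set X).
Implicit Types A B C : set Y.

Definition sub_bounded : set (set Y) :=
  [set A | exists2 B : set X, coarse_bounded B & A = set_val @^-1` B].

Definition sub_near A C := coarse_near (set_val @` A) (set_val @` C).

Let sub_boundedE A : sub_bounded A <-> coarse_bounded (set_val @` A).
Proof.
split=> [[B bB ->]|bA].
  by apply: coarse_boundedS bB => _ [y By <-].
exists (set_val @` A) => //; apply/seteqP; split=> [y Ay|y [z Az] /val_inj <- //].
by exists y.
Qed.

Let sub_bounded1 (y : Y) : sub_bounded [set y].
Proof. by apply/sub_boundedE; rewrite image_set1; exact: coarse_bounded1. Qed.

Let sub_boundedS A B : A `<=` B -> sub_bounded B -> sub_bounded A.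
Proof.
move=> AB /sub_boundedE bB; apply/sub_boundedE.
by apply: coarse_boundedS bB; exact: image_subset.
Qed.

Let sub_boundedU A B : sub_bounded A -> sub_bounded B -> sub_bounded (A `|` B).
Proof.
move=> /sub_boundedE bA /sub_boundedE bB; apply/sub_boundedE.
by rewrite image_setU; exact: coarse_boundedU.
Qed.

Let sub_near_sym A B : sub_near A B -> sub_near B A.
Proof. exact: coarse_near_sym. Qed.

Let sub_near_unbounded A B :
  sub_near A B -> ~ sub_bounded A /\ ~ sub_bounded B.
Proof. by move=> /coarse_near_unbounded[nA nB]; split=> /sub_boundedE. Qed.

Let sub_nearI A B : ~ sub_bounded (A `&` B) -> sub_near A B.
Proof.
move=> nAB; apply: coarse_nearI => bAB; apply: nAB; apply/sub_boundedE.
by apply: coarse_boundedS bAB => _ [y [Ay By] <-]; split; exists y.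
Qed.

Let sub_nearU A B C : sub_near (A `|` B) C <-> sub_near A C \/ sub_near B C.
Proof. by rewrite /sub_near image_setU; exact: coarse_nearU. Qed.

Let sub_near_strong A B : ~ sub_near A B ->
  exists E, ~ sub_near A E /\ ~ sub_near (~` E) B.
Proof.
move=> /coarse_near_strong[E [AE EB]]; exists (set_val @^-1` E); split.
  by apply: contra_not AE; apply: coarse_nearSS => // _ [y Ey <-].
by apply: contra_not EB; apply: coarse_nearSS => // _ [y Ey <-].
Qed.

HB.instance Definition _ := isCoarseProximity.Build (set_type Y)
  sub_bounded1 sub_boundedS sub_boundedU sub_near_sym sub_near_unbounded
  sub_nearI sub_nearU sub_near_strong.

End subspace.

Definition weak_asymptotic_resemblance (X : coarseProximityType)
    (A B : set X) :=
  (forall B', B' `<=` B -> ~ coarse_bounded B' -> coarse_near A B') /\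
  (forall A', A' `<=` A -> ~ coarse_bounded A' -> coarse_near A' B).

Definition coarse_proximity_map (X Y : coarseProximityType) (f : X -> Y) :=
  (forall B : set X, coarse_bounded B -> coarse_bounded (f @` B)) /\
  (forall A B : set X, coarse_near A B -> coarse_near (f @` A) (f @` B)).

Definition coarse_close (X : Type) (Y : coarseProximityType) (f g : X -> Y) :=
  forall A : set X, weak_asymptotic_resemblance (f @` A) (g @` A).

Definition coarse_proximity_isomorphism (X Y : coarseProximityType)
    (f : X -> Y) :=
  coarse_proximity_map f /\
  exists g : Y -> X, [/\ coarse_proximity_map g,
    coarse_close (g \o f) id & coarse_close (f \o g) id].

Definition coarse_proximity_isomorphic (X Y : coarseProximityType) :=
  exists f : X -> Y, coarse_proximity_isomorphism f.

Definition discrete_extension (X : coarseProximityType) (A B : set X) :=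
  (A `&` B !=set0) \/ coarse_near A B.

Record smirnov (X : coarseProximityType) := Cluster {
  cluster_sets :> set X -> Prop;
  cluster_nonempty : forall A, cluster_sets A -> A !=set0;
  cluster_near : forall A B,
    cluster_sets A -> cluster_sets B -> discrete_extension A B;
  cluster_max : forall C,
    (forall A, cluster_sets A -> discrete_extension C A) -> cluster_sets C;
  cluster_union : forall A B,
    cluster_sets (A `|` B) -> cluster_sets A \/ cluster_sets B
}.

HB.instance Definition _ (X : coarseProximityType) :=
  gen_eqMixin (smirnov X).
HB.instance Definition _ (X : coarseProximityType) :=
  gen_choiceMixin (smirnov X).

Definition smirnov_near (X : coarseProximityType) (S T : set (smirnov X)) :=
  forall A C : set X, (forall s : smirnov X, S s -> s A) ->
    (forall s : smirnov X, T s -> s C) -> discrete_extension A C.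

Section smirnov_topology.
Context {X : coarseProximityType}.
Implicit Types (s : smirnov X) (S T : set (smirnov X)) (A C : set X).

Lemma clusterS s A C : A `<=` C -> s A -> s C.
Proof.
move=> AC sA; apply: cluster_max => D sD.
have [[x [Ax Dx]]|nAD] := cluster_near sA sD.
  by left; exists x; split=> //; exact: AC.
by right; exact: coarse_nearS nAD.
Qed.

Lemma smirnov_near1 s T :
  smirnov_near [set s] T <-> forall C, (forall t, T t -> t C) -> s C.
Proof.
split=> [sT C TC|sT A C sA TC].
  apply: cluster_max => A sA.
  have [_ ->//|//|[x [Ax Cx]]|AC] := sT A C.
    by left; exists x.
  by right; exact: coarse_near_sym.
by apply: cluster_near (sT _ TC); exact: sA.
Qed.

Let smirnov_closed T := forall s, smirnov_near [set s] T -> T s.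

Definition smirnov_open : set (set (smirnov X)) :=
  [set S | smirnov_closed (~` S)].

Let smirnov_openT : smirnov_open setT.
Proof.
move=> s /smirnov_near1 /(_ set0) s0; exfalso.
by have /cluster_nonempty[] : s set0 by apply: s0 => t; rewrite setCT.
Qed.

Let smirnov_openI : setI_closed smirnov_open.
Proof.
move=> S T oS oT s /smirnov_near1 sST; rewrite setCI.
apply: contrapT => /not_orP[nS nT].
have /existsNP[C /not_implyP[SC nsC]] :
    ~ forall C, (forall t : smirnov X, (~` S) t -> t C) -> s C.
  by move=> /smirnov_near1 /oS.
have /existsNP[D /not_implyP[TD nsD]] :
    ~ forall C, (forall t : smirnov X, (~` T) t -> t C) -> s C.
  by move=> /smirnov_near1 /oT.
have /cluster_union[] // : s (C `|` D).
apply: sST => t; rewrite setCI => -[/SC|/TD]; apply: clusterS => x; by [left|right].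
Qed.

Let smirnov_open_bigU (I : Type) (f : I -> set (smirnov X)) :
  (forall i, smirnov_open (f i)) -> smirnov_open (\bigcup_i f i).
Proof.
move=> of_ s /smirnov_near1 sf [i _ fis]; apply: (of_ i s) => //.
apply/smirnov_near1 => C fC; apply: sf => t nt; apply: fC => fit.
by apply: nt; exists i.
Qed.

HB.instance Definition _ := isOpenTopological.Build (smirnov X)
  smirnov_openT smirnov_openI smirnov_open_bigU.

Lemma smirnov_openE S : open S <-> smirnov_open S.
Proof. by []. Qed.

Lemma smirnov_closureE S : closure S = [set s | smirnov_near [set s] S].
Proof.
apply/seteqP; split; last first.
  move=> s /smirnov_near1 sS.
  rewrite closureE => F [cF SF]; rewrite -[F]setCK.
  have /smirnov_openE := closed_openC cF; apply.
  apply/smirnov_near1 => C; rewrite setCK => FC; apply: sS => t /SF; exact: FC.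
rewrite closureE; apply: smallest_sub.
  rewrite -openC; apply/smirnov_openE => s; rewrite setCK => /smirnov_near1 sS.
  by apply/smirnov_near1 => C SC; apply: sS => t /smirnov_near1; exact.
by move=> s Ss; apply/smirnov_near1 => C; exact.
Qed.

End smirnov_topology.

Section point_cluster.
Context {X : coarseProximityType} (x : X).
Let sets : set (set X) := [set A | A x].

Let nonempty A : sets A -> A !=set0.
Proof. by move=> Ax; exists x. Qed.

Let near A B : sets A -> sets B -> discrete_extension A B.
Proof. by move=> Ax Bx; left; exists x. Qed.

Let max C : (forall A, sets A -> discrete_extension C A) -> sets C.
Proof.
move=> /(_ [set x] erefl)[[y [Cy yx]]|/coarse_near_unbounded[_]].
  by rewrite /sets /= -[x]yx.
by have := coarse_bounded1 x.
Qed.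

Let union A B : sets (A `|` B) -> sets A \/ sets B.
Proof. by []. Qed.

Definition point_cluster : smirnov X := Cluster nonempty near max union.

End point_cluster.

Definition smirnov_cl (X : coarseProximityType) (A : set X) :
    set (smirnov X) :=
  closure ((@point_cluster X) @` A).

Lemma smirnov_clE (X : coarseProximityType) (A : set X) :
  smirnov_cl A = [set s : smirnov X | s A].
Proof.
rewrite /smirnov_cl smirnov_closureE.
apply/seteqP; split=> s /= => [/smirnov_near1 sA|sA].
  by apply: sA => _ [x Ax <-].
apply/smirnov_near1 => C AC; apply: clusterS sA => x Ax.
by apply: (AC (point_cluster x)); exists x.
Qed.

Definition coarse_boundary (X : coarseProximityType) : set (smirnov X) :=
  [set s | forall B, coarse_bounded B -> ~ s B].
Arguments coarse_boundary : clear implicits.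

(* Subsets of the boundary live in the type [set_type (coarse_boundary X)],
   whose topology is the one induced by the Smirnov compactification. *)
Definition coarse_trace (X : coarseProximityType) (A : set X) :
    set (coarse_boundary X) :=
  set_val @^-1` smirnov_cl A.

Definition separator (T : topologicalType) (A B C : set T) :=
  exists U V : set T, [/\ open U /\ open V, U `&` V = set0,
    ~` C = U `|` V, A `<=` U & B `<=` V].

Definition asymptotic_separator (X : coarseProximityType) (A B C : set X) :=
  separator (coarse_trace A) (coarse_trace B) (coarse_trace C).

(* [asInd_lt k X] means asInd(X) <= k - 1: the shift lets the recursion start
   at dimension -1. *)
Fixpoint asInd_lt (k : nat) (X : coarseProximityType) : Prop :=
  match k with
  | 0 => coarse_bounded [set: X]
  | k'.+1 => forall A B : set X, ~ coarse_near A B ->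
      exists C : set X, asymptotic_separator A B C /\ asInd_lt k' (set_type C)
  end.

Definition asInd (X : coarseProximityType) : \bar int :=
  match pselect (exists k, `[< asInd_lt k X >]) with
  | left ex => ((ex_minn ex)%:Z - 1)%R%:E
  | right _ => +oo%E
  end.

Lemma asInd_finP (X : coarseProximityType) (k : nat) :
  asInd X = (k%:Z - 1)%R%:E <->
  asInd_lt k X /\ forall j, asInd_lt j X -> (k <= j)%N.
Proof.
rewrite /asInd; case: pselect => [ex|nex]; last first.
  by split=> // -[kX _]; case: nex; exists k; apply/asboolP.
case: ex_minnP => m /asboolP mX minm; split=> [mk|[kX mink]].
  have /addIr[<-] : (m%:Z - 1 = k%:Z - 1)%R := congr1 fine mk.
  by split=> // j jX; apply: minm; apply/asboolP.
congr (_%:Z - 1)%R%:E; apply/eqP; rewrite eqn_leq mink // minm //.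
exact/asboolP.
Qed.

Lemma asInd_pinftyP (X : coarseProximityType) :
  asInd X = +oo%E <-> forall k, ~ asInd_lt k X.
Proof.
rewrite /asInd; case: pselect => [ex|nex].
  by split=> // nX; exfalso; case: ex => k /asboolP /nX.
by split=> // _ k kX; apply: nex; exists k; apply/asboolP.
Qed.

(* Main.v *)
Require Import Defs.
From mathcomp Require Import all_boot all_order all_algebra.
From mathcomp Require Import all_classical all_reals.
From mathcomp Require Import topology.

(** Why the theorem holds.  By symmetry it is enough to transport an upper
    bound on the dimension along an isomorphism [f : X -> Y] with coarse inverse
    [g], by induction on the bound ([asInd_lt_isomorphic]).

    Everything rests on the fact that the weak asymptotic resemblance cannot be
    seen by the coarse proximity ([near_resemblance]).  It follows that [f]
    both preserves and reflects boundedness and nearness, since [g (f A)]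
    resembles [A].  Two consequences carry the induction step.

    - A boundary cluster [t] of [Y] pulls back to the boundary cluster
      [{C | f C \in t}] of [X]; this is a continuous map from the boundary of
      [Y] to that of [X] ([boundary_pullback_continuous]).  The preimage of the
      trace of [C] is, by construction, the trace of [f C], and the preimage of
      the trace of [g A] contains the trace of [A].  Hence, if [C] separates
      [g A] from [g B] asymptotically, then [f C] separates [A] from [B]: pull
      back the two open sets.

    - The subspaces [C] and [f C] are again isomorphic
      ([isomorphic_image]), so the induction hypothesis applies to the
      separator. *)

Set Implicit Arguments.
Unset Strict Implicit.
Unset Printing Implicit Defensive.
Local Open Scope classical_set_scope.

(** * Weak asymptotic resemblance *)

Section resemblance.
Context {X : coarseProximityType}.
Implicit Types A B C D : set X.

Lemma resemblance_refl A :
  weak_asymptotic_resemblance A A.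
Proof.
by split=> S SA nS; apply: coarse_nearI; [rewrite setIidr|rewrite setIidl].
Qed.

Lemma resemblance_sym A B :
  weak_asymptotic_resemblance A B -> weak_asymptotic_resemblance B A.
Proof.
by move=> [AB BA]; split=> S SS nS; apply: coarse_near_sym; [exact: BA|exact: AB].
Qed.

(** If [D] were far from [B], the strong axiom would give [E] far from [D] whose
    complement is far from [B].  Being near [D], the set [A] must be near [D]
    outside [E]; so [A `\` E] is an unbounded part of [A] far from [B]. *)
Lemma near_resemblance A B D :
  weak_asymptotic_resemblance A B -> coarse_near D A -> coarse_near D B.
Proof.
move=> [_ AB] DA; apply: contrapT => /coarse_near_strong[E [DE EB]].
have := DA; rewrite -(setUIDK A E) => /coarse_near_sym /coarse_nearU[AED|AED].
  apply: DE; apply: coarse_near_sym; apply: coarse_nearS AED; exact: subIsetr.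
apply: EB; apply: (@coarse_nearS _ (A `\` E)); first by move=> x [].
by apply: AB => [x []//|]; case/coarse_near_unbounded: AED.
Qed.

Lemma bounded_resemblance A B :
  weak_asymptotic_resemblance A B -> coarse_bounded A -> coarse_bounded B.
Proof.
move=> [AB _] bA; apply: contrapT => nB.
by have /coarse_near_unbounded[] := AB B (@subset_refl _ B) nB.
Qed.

Lemma resemblance_trans A B C : weak_asymptotic_resemblance A B ->
  weak_asymptotic_resemblance B C -> weak_asymptotic_resemblance A C.
Proof.
move=> AB BC; split=> S SS nS.
  apply: coarse_near_sym; apply: (near_resemblance (resemblance_sym AB)).
  by apply: coarse_near_sym; apply: BC.1.
by apply: (near_resemblance BC); apply: AB.2.
Qed.

Lemma near_resemblance2 A A' B B' :
  weak_asymptotic_resemblance A A' -> weak_asymptotic_resemblance B B' ->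
  coarse_near A B -> coarse_near A' B'.
Proof.
move=> AA' BB' /(near_resemblance BB') /coarse_near_sym.
by move=> /(near_resemblance AA') /coarse_near_sym.
Qed.

End resemblance.

(** * Maps with a coarse left inverse *)

Section coarse_left_inverse.
Context {X Y : coarseProximityType} (f : X -> Y) (g : Y -> X).
Context (gP : coarse_proximity_map g) (gfK : coarse_close (g \o f) id).

Lemma resemblance_cancel (A : set X) :
  weak_asymptotic_resemblance (g @` (f @` A)) A.
Proof. by have := gfK A; rewrite image_id -image_comp. Qed.

Lemma near_image_inv (A B : set X) :
  coarse_near (f @` A) (f @` B) -> coarse_near A B.
Proof.
by move=> /gP.2; apply: near_resemblance2; exact: resemblance_cancel.
Qed.

Lemma bounded_image_inv (A : set X) : coarse_bounded (f @` A) -> coarse_bounded A.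
Proof. by move=> /gP.1; apply: bounded_resemblance; exact: resemblance_cancel. Qed.

(** Both sets resemble the image under [g] of their common image under [f]. *)
Lemma resemblance_same_image (A B : set X) :
  f @` A = f @` B -> weak_asymptotic_resemblance A B.
Proof.
move=> fAB; apply: resemblance_trans (resemblance_cancel B).
by rewrite -fAB; apply: resemblance_sym; exact: resemblance_cancel.
Qed.

End coarse_left_inverse.

(** * Subspaces *)

Section subspace.
Context {X : coarseProximityType} (C : set X).

Lemma bounded_subspaceE (A : set C) :
  coarse_bounded A <-> coarse_bounded (set_val @` A).
Proof.
split=> [[B bB ->]|bA].
  by apply: coarse_boundedS bB => _ [y By <-].
exists (set_val @` A) => //; apply/seteqP; split=> [y Ay|y [z Az] /val_inj <- //].
by exists y.
Qed.

Lemma resemblance_subspace (A B : set C) :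
  weak_asymptotic_resemblance (set_val @` A) (set_val @` B) ->
  weak_asymptotic_resemblance A B.
Proof.
move=> [AB BA]; split=> S SS nS.
  by apply: AB; [exact: image_subset|move=> /bounded_subspaceE].
by apply: BA; [exact: image_subset|move=> /bounded_subspaceE].
Qed.

End subspace.

(** The inverse is any set-theoretic section [h] of [f : C -> f C], rather than
    the restriction of [g], which need not map [f C] into [C].  A section is
    good enough because [f] reflects boundedness, nearness and resemblance. *)
Lemma isomorphic_image (X Y : coarseProximityType) (f : X -> Y) (C : set X) :
  coarse_proximity_isomorphism f ->
  coarse_proximity_isomorphic (set_type C) (set_type (f @` C)).
Proof.
move=> [fP [g [gP gfK _]]].
pose fC (x : C) : set_type (f @` C) :=
  SigSub (mem_set (imageP f (set_valP x))).
have /choice[h hK] : forall y : set_type (f @` C), exists x : C, fC x = y.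
  move=> y; have [x Cx fxy] := set_valP y.
  by exists (SigSub (mem_set Cx)); apply: val_inj.
have fCE (A : set C) : set_val @` (fC @` A) = f @` (set_val @` A).
  by rewrite !image_comp.
have fhE (A : set (set_type (f @` C))) :
    f @` (set_val @` (h @` A)) = set_val @` A.
  rewrite -fCE; congr (_ @` _); rewrite image_comp (eq_imagel (f' := id)).
    exact: image_id.
  by move=> y _; exact: hK.
exists fC; split.
  split=> [B /bounded_subspaceE bB|A B AB].
    by apply/bounded_subspaceE; rewrite fCE; exact: fP.1.
  by rewrite /coarse_near /= /sub_near !fCE; exact: fP.2.
exists h; split.
- split=> [B /bounded_subspaceE bB|A B AB].
    by apply/bounded_subspaceE; apply: (bounded_image_inv gP gfK); rewrite fhE.
  by apply: (near_image_inv gP gfK); rewrite !fhE.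
- move=> A; rewrite image_id -image_comp; apply: resemblance_subspace.
  by apply: (resemblance_same_image gfK); rewrite fhE fCE.
- move=> A; rewrite (eq_imagel (f' := id)); first exact: resemblance_refl.
  by move=> y _; exact: hK.
Qed.

(** * Pulling back boundary clusters *)

Lemma coarse_traceE (X : coarseProximityType) (A : set X) :
  coarse_trace A = [set s : coarse_boundary X | set_val s A].
Proof. by rewrite /coarse_trace smirnov_clE. Qed.

Section boundary_cluster.
Context {X : coarseProximityType} (s : smirnov X).
Context (sU : coarse_boundary X s).
Implicit Types A B C : set X.

(** By the union axiom, [s] contains one of the two parts of [A]; the bounded one
    is excluded. *)
Lemma boundary_clusterD A B : s A -> coarse_bounded (A `&` B) -> s (A `\` B).
Proof.
by move=> sA bAB; move: sA; rewrite -{1}(setUIDK A B) => /cluster_union[/(sU bAB)|].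
Qed.

(** Members cannot merely intersect: were they far from each other, their
    intersection would be bounded and could be removed from one of them. *)
Lemma boundary_cluster_near A B : s A -> s B -> coarse_near A B.
Proof.
move=> sA sB; apply: contrapT => nAB.
have bAB : coarse_bounded (A `&` B).
  by apply: contrapT => /coarse_nearI.
have [[x [[_ nBx] Bx]]//|] := cluster_near (boundary_clusterD sA bAB) sB.
by move=> ABB; apply: nAB; apply: coarse_nearS ABB; exact: subDsetl.
Qed.

Lemma boundary_cluster_max C : (forall A, s A -> coarse_near C A) -> s C.
Proof. by move=> sC; apply: cluster_max => A /sC; right. Qed.

Lemma boundary_cluster_resemblance A B :
  weak_asymptotic_resemblance A B -> s A -> s B.
Proof.
move=> AB sA; apply: boundary_cluster_max => D sD; apply: coarse_near_sym.
by apply: (near_resemblance AB); exact: boundary_cluster_near.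
Qed.

End boundary_cluster.

Section pullback.
Context {X Y : coarseProximityType} (f : X -> Y) (g : Y -> X).
Context (fP : coarse_proximity_map f) (gP : coarse_proximity_map g).
Context (gfK : coarse_close (g \o f) id) (fgK : coarse_close (f \o g) id).

Section cluster.
Context (t : coarse_boundary Y).
Let tU : coarse_boundary Y (set_val t) := set_valP t.
Let sets : set (set X) := [set C | set_val t (f @` C)].

Let nonempty A : sets A -> A !=set0.
Proof. by move=> /cluster_nonempty[_ [x Ax _]]; exists x. Qed.

Let near A B : sets A -> sets B -> discrete_extension A B.
Proof.
move=> tA tB; right; apply: (near_image_inv gP gfK).
exact: boundary_cluster_near tA tB.
Qed.

Lemma boundary_cluster_cancel (A : set Y) :
  set_val t A -> set_val t (f @` (g @` A)).
Proof.
apply: boundary_cluster_resemblance => //; apply: resemblance_sym.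
exact: resemblance_cancel fgK A.
Qed.

(** It suffices that [C] is near [g D] for each [D] in [t].  If not, [C] meets
    [g D] in a bounded set, and [g D `\` C] still belongs to the pullback; being
    disjoint from [C], it can only be close to [C] by being near it. *)
Let max C : (forall A, sets A -> discrete_extension C A) -> sets C.
Proof.
move=> Cmax; apply: boundary_cluster_max => D tD.
suff CgD : coarse_near C (g @` D).
  by apply: (near_resemblance (resemblance_cancel fgK D)); exact: fP.2.
apply: contrapT => nCgD.
have bCgD : coarse_bounded (g @` D `&` C).
  by apply: contrapT; rewrite setIC => /coarse_nearI.
have : sets (g @` D `\` C).
  have := boundary_cluster_cancel tD.
  rewrite -{1}(setUIDK (g @` D) C) image_setU => /cluster_union[|//].
  by move=> /(tU (fP.1 _ bCgD)).
move=> /Cmax[[x [Cx [_ nCx]]]//|]; apply: contra_not nCgD.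
by apply: coarse_nearSS => //; exact: subDsetl.
Qed.

Let union A B : sets (A `|` B) -> sets A \/ sets B.
Proof. by rewrite /sets /= image_setU; exact: cluster_union. Qed.

Let pullback : smirnov X := Cluster nonempty near max union.

Let pullbackU : coarse_boundary X pullback.
Proof. by move=> B /fP.1 bfB; exact: tU. Qed.

Definition boundary_pullback : coarse_boundary X := SigSub (mem_set pullbackU).

End cluster.

(** If [t] lies in the closure of the preimage of a closed set [T], and [C] is a
    common member of the clusters in [T], then [f C] is a common member of the
    clusters of that preimage, hence a member of [t]; that is, [C] is a member
    of the pullback of [t], which therefore lies in the closure of [T]. *)
Lemma boundary_pullback_continuous : continuous boundary_pullback.
Proof.
apply/continuousP => _ [O oO <-].
pose P : set (smirnov Y) :=
  set_val @` (boundary_pullback @^-1` (set_val @^-1` (~` O))).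
exists (~` closure P); first exact/closed_openC/closed_closure.
apply/seteqP; split=> t /=; last first.
  move=> Ot; rewrite smirnov_closureE => /smirnov_near1 tP.
  move/smirnov_openE: oO => /(_ (set_val (boundary_pullback t))); apply => //.
  apply/smirnov_near1 => C OC; apply: tP => _ [u Ou <-].
  exact: OC (set_val (boundary_pullback u)) Ou.
move=> nPt; apply: contrapT => nO; apply: nPt; apply: subset_closure.
by exists t.
Qed.

Lemma asymptotic_separator_image (A B : set Y) (C : set X) :
  asymptotic_separator (g @` A) (g @` B) C ->
  asymptotic_separator A B (f @` C).
Proof.
have trace_sub D (t : coarse_boundary Y) :
    coarse_trace D t -> coarse_trace (g @` D) (boundary_pullback t).
  by rewrite !coarse_traceE; exact: boundary_cluster_cancel.
move=> [U [V [[oU oV] UV0 CUV AU BV]]].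
exists (boundary_pullback @^-1` U), (boundary_pullback @^-1` V); split.
- have cF := (continuousP _).1 boundary_pullback_continuous.
  by split; apply: cF.
- by rewrite -preimage_setI UV0 preimage_set0.
- by rewrite -preimage_setU -CUV -preimage_setC !coarse_traceE.
- by move=> t /trace_sub /AU.
- by move=> t /trace_sub /BV.
Qed.

End pullback.

(** * Invariance of the dimension *)

Lemma isomorphic_sym (X Y : coarseProximityType) :
  coarse_proximity_isomorphic X Y -> coarse_proximity_isomorphic Y X.
Proof. by move=> [f [fP [g [gP gfK fgK]]]]; exists g; split=> //; exists f. Qed.

Lemma asInd_lt_isomorphic (k : nat) (X Y : coarseProximityType) :
  coarse_proximity_isomorphic X Y -> asInd_lt k X -> asInd_lt k Y.
Proof.
elim: k X Y => [|k IHk] X Y [f fI]; have [fP [g [gP gfK fgK]]] := fI => /=.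
  move=> bX; apply: (bounded_image_inv fP fgK).
  exact: coarse_boundedS bX.
move=> indX A B nAB.
have [|C [CAB indC]] := indX (g @` A) (g @` B).
  by move=> /(near_image_inv fP fgK).
exists (f @` C); split; first exact: asymptotic_separator_image CAB.
exact: IHk (isomorphic_image C fI) indC.
Qed.

Theorem theorem3p9 (X Y : coarseProximityType)
    (hXY : coarse_proximity_isomorphic X Y) :
  asInd X = asInd Y.
Proof.
have indE k : asInd_lt k X <-> asInd_lt k Y.
  by split; apply: asInd_lt_isomorphic => //; exact: isomorphic_sym.
rewrite [RHS]/asInd; case: pselect => [ex|nex].
  case: ex_minnP => m /asboolP /indE mX minm; apply/asInd_finP; split=> // j.
  by move=> /indE jY; apply: minm; exact/asboolP.
by apply/asInd_pinftyP => k /indE kY; apply: nex; exists k; exact/asboolP.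
Qed.
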